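(* There exists an absolute constant $c>0$ such that for all integers $n\ge r\ge 2$ with $r\le c\,\frac{n}{\ln n}$, $$p(n,r)\ge c\,\max\left(\frac{n^{1/4}}{r\sqrt r},\ \frac{1}{\sqrt n}\right)\left(\frac{r}{r-1}\right)^n .$$
   Context: A hypergraph is a pair $(V,E)$ where $V$ is a finite set (of vertices) and $E$ is a family of subsets of $V$ (edges). It is $n$-uniform if every edge has size $n$. A vertex $r$-coloring is a map $V\to\{1,\dots,r\}$; it is called panchromatic if every edge contains a vertex of every one of the $r$ colors. $p(n,r)$ denotes the minimal number of edges of an $n$-uniform hypergraph that has no panchromatic $r$-coloring. *)

(* Defs.v *)
From mathcomp Require Import all_boot.
From mathcomp Require Import boolp classical_sets.

Set Implicit Arguments.
Unset Strict Implicit.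
Unset Printing Implicit Defensive.

Record hypergraph := Hypergraph {
  vertex : finType;
  edges : {set {set vertex}}
}.

Definition uniform (n : nat) (H : hypergraph) : Prop :=
  forall e, e \in edges H -> #|e| = n.

Definition panchromatic (H : hypergraph) (r : nat) (f : vertex H -> 'I_r) : Prop :=
  forall e, e \in edges H -> forall k : 'I_r, exists2 v, v \in e & f v = k.

Definition panchromatic_colorable (r : nat) (H : hypergraph) : Prop :=
  exists f : vertex H -> 'I_r, panchromatic f.

Definition non_panchromatic_size (n r m : nat) : Prop :=
  exists H : hypergraph,
    [/\ uniform n H, ~ panchromatic_colorable r H & #|edges H| = m].

(* The default value 0 is only taken when no [n]-uniform hypergraph without a
   panchromatic [r]-coloring exists, which is excluded for [r >= 2] by
   [non_panchromatic_size_ex] below. *)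
Definition p (n r : nat) : nat :=
  xget 0 [set m | non_panchromatic_size n r m /\
                  forall k, non_panchromatic_size n r k -> m <= k]%classic.

Lemma non_panchromatic_size_ex (n r : nat) :
  1 < r -> exists m, non_panchromatic_size n r m.
Proof.
move=> r1; pose V := 'I_(n + n).
pose H := @Hypergraph V [set e : {set V} | #|e| == n].
exists #|edges H|, H; split=> // [e|]; first by rewrite inE => /eqP.
case=> f fP.
have no_k (k : 'I_r) : #|[set v : V | f v != k]| < n.
  rewrite ltnNge; apply/negP => /card_geqP[s [us ss sS]].
  have /fP/(_ k)[v] : [set v in s] \in edges H.
    by rewrite inE cardsE (card_uniqP us) ss.
  by rewrite inE => /sS; rewrite inE => /eqP.
pose k0 : 'I_r := Ordinal (ltnW r1); pose k1 : 'I_r := Ordinal r1.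
have : n + n <= #|[set v | f v != k0] :|: [set v | f v != k1]|.
  rewrite -[X in X <= _]card_ord subset_leq_card //; apply/fintype.subsetP => v _.
  by rewrite !inE; case: eqVneq => //= ->.
move=> /leq_trans/(_ (leq_card_setU _ _).1).
by rewrite leqNgt -addSn leq_add // ltnW.
Qed.

Lemma pP (n r : nat) : 1 < r ->
  non_panchromatic_size n r (p n r) /\
  forall k, non_panchromatic_size n r k -> p n r <= k.
Proof.
move=> /(non_panchromatic_size_ex n)[m mP].
have ex : exists m, `[< non_panchromatic_size n r m >] by exists m; apply/asboolP.
rewrite /p; case: xgetP => [_ _ //|/(_ (ex_minn ex))[]].
by case: ex_minnP => k /asboolP kP kmin; split=> // j jP; apply/kmin/asboolP.
Qed.

(* Main.v *)
Require Import Defs.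
From mathcomp Require Import all_boot all_order all_algebra.
From mathcomp Require Import reals exp.
From mathcomp Require Import sequences ring lra zify.

(** Scatter the vertices independently and uniformly on a circle cut into [r]
    zones, one per color, each zone consisting of [n] consecutive levels; so a
    weighting is a function from the vertices to ['I_r * 'I_n], and every
    probability below is a ratio of cardinals. A vertex of zone [i] receives
    color [i], except that the last [K] levels of the zone form a buffer whose
    vertices may move on to the next color. A buffer vertex [v] of zone [i]
    does so exactly when some edge through [v] needs it: the edge has no vertex
    after [v] in zone [i] and none at all in zone [i + 1], so that [v] is its
    last hope of getting color [i + 1].

    By [panchromatic_color] an edge can then miss a color in two ways only.
    - It misses the arc made of the zone of that color and the buffer just
      before it. This arc has [n + K] of the [r * n] positions, and for
      [K = (r - 1) * d] the probability of missing it is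
      [((1 - 1/r) * (1 - d/n)) ^ n], so the buffer gains a factor [exp (- d)],
      which is at most [1/n] for [d] of order [ln n].
    - Two edges [e], [f] share a buffer vertex [u] such that [e] avoids all that
      comes later than [u] (up to the end of the next zone) while [f] avoids all
      that comes earlier in the zone of [u]. The two avoided sets have [2n - 1]
      positions in total, wherever [u] lies, so by the inequality between
      arithmetic and geometric means this costs about [(1 - 1/r) ^ (2n)]; and
      [u] must lie in a buffer, which has probability [K/n = O(r * ln n / n)].

    A union bound over the common vertices [u] would cost a factor
    [s = #|e :&: f|]. However, a common vertex has to avoid both sets at once,
    which is less likely than two independent avoidances by a factor
    [1 - y], with [y] about [1 / r ^ 2]; hence the actual factor is
    [s * (1 - y) ^ (s - 1)], which is at most [n] and at most [1 / y = O(r ^ 2)].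
    With [x = #|edges H| * (1 - 1/r) ^ n], a good weighting therefore exists
    as soon as [x * r / n] and [x ^ 2 * r * ln n * min(n, r ^ 2) / n] are small
    ([colorable_of_few_edges]). Bounding the minimum by [n] gives
    [x = c / sqrt n], because [r * ln n <= c * n]; bounding it by [r ^ 2] gives
    [x = c * n ^ (1/4) / r ^ (3/2)], because [ln n = O(sqrt n)]. *)

Set Implicit Arguments.
Unset Strict Implicit.
Unset Printing Implicit Defensive.

Import Order.TTheory GRing.Theory Num.Theory.
Local Open Scope ring_scope.

(** * The coloring attached to a weighting *)

Section Coloring.
Local Open Scope nat_scope.
Variables (H : hypergraph) (r n K : nat).
Implicit Types (e f : {set vertex H}) (x : 'I_r * 'I_n) (i : 'I_r).
Implicit Types (w : {ffun vertex H -> 'I_r * 'I_n}).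

Definition buffer : {set 'I_r * 'I_n} := [set x : 'I_r * 'I_n | n - K <= x.2].

(** All positions whose vertices may receive color [i]. *)
Definition arc i : {set 'I_r * 'I_n} :=
  [set x : 'I_r * 'I_n | (x.1 == i) || (ordS x.1 == i) && (x \in buffer)].

Definition later x : {set 'I_r * 'I_n} :=
  [set y : 'I_r * 'I_n | (y.1 == x.1) && (x.2 < y.2) || (y.1 == ordS x.1)].

Definition earlier x : {set 'I_r * 'I_n} :=
  [set y : 'I_r * 'I_n | (y.1 == x.1) && (y.2 < x.2)].

Definition avoids w e (X : {set 'I_r * 'I_n}) := [forall v in e, w v \notin X].

Definition advanced w (v : vertex H) :=
  (w v \in buffer) &&
  [exists e in edges H, (v \in e) && avoids w e (later (w v))].

Definition color w v : 'I_r := if advanced w v then ordS (w v).1 else (w v).1.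

(** Suppose that [e] meets the arc of [i]. If [e] has vertices in zone [i], take
    the first one: should it have moved on to the next color, the edge that
    made it move, together with [e], forms the excluded pair. Otherwise the
    vertices of [e] in the arc lie in the buffer before zone [i], and [e] itself
    makes the last of them move to [i]. *)
Lemma panchromatic_color w :
  (forall e i, e \in edges H -> ~~ avoids w e (arc i)) ->
  (forall e f v, e \in edges H -> f \in edges H -> v \in e -> v \in f ->
     w v \in buffer ->
     ~~ (avoids w e (later (w v)) && avoids w f (earlier (w v)))) ->
  panchromatic (color w).
Proof.
move=> hit noclash e eH i.
case: (pickP [pred v in e | (w v).1 == i]) => [v0 v0P|none].
  case: (arg_minnP (fun v => nat_of_ord (w v).2) v0P) => u /andP[ue /eqP ui] umin.
  exists u => //; rewrite /color; case: ifP => // /andP[ub].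
  case/exists_inP => f fH /andP[uf flater].
  have /negP[] := noclash f e u fH eH uf ue ub; rewrite flater /=.
  apply/forall_inP => v ve; rewrite inE negb_and -leqNgt -implybE ui.
  by apply/implyP => vi; apply: umin; rewrite /= ve.
have /forall_inPn[v0 v0e] := hit e i eH; rewrite negbK inE.
have := none v0; rewrite /= v0e /= => -> /= /andP[/eqP v0i v0b].
have v0P : [pred v in e | (w v).1 == (w v0).1] v0 by rewrite /= v0e eqxx.
case: (arg_maxnP (fun v => nat_of_ord (w v).2) v0P) => u /andP[ue /eqP ui] umax.
exists u => //; rewrite /color ui v0i; case: ifPn => // /negP[].
apply/andP; split.
  move: v0b; rewrite !inE => /leq_trans; apply; exact: umax.
apply/exists_inP; exists e => //; rewrite ue; apply/forall_inP => v ve.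
rewrite inE negb_or negb_and -leqNgt -implybE ui v0i; apply/andP; split.
  by apply/implyP => vi; apply: umax; rewrite /= ve.
by have := none v; rewrite /= ve /= => ->.
Qed.

End Coloring.

(** * Uniform probability on finite types *)

Section Density.
Variable R : realFieldType.

Definition density (T : finType) (A : {set T}) : R := #|A|%:R / #|T|%:R.

Lemma density_ge0 (T : finType) (A : {set T}) : 0 <= density A.
Proof. by rewrite divr_ge0. Qed.

Lemma densityT (T : finType) : (0 < #|T|)%N -> density [set: T] = 1.
Proof. by move=> T0; rewrite /density cardsT divff// pnatr_eq0 -lt0n. Qed.

Lemma densityC (T : finType) (A : {set T}) : (0 < #|T|)%N ->
  density (~: A) = 1 - density A.
Proof.
move=> T0; rewrite -(densityT T0) /density -mulrBl cardsT -(cardsC A).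
by rewrite natrD addrAC subrr add0r.
Qed.

(** The values of a uniformly random function are independent and uniform. *)
Lemma density_family (V W : finType) (F : V -> {set W}) :
  density [set w : {ffun V -> W} | [forall v, w v \in F v]] =
  \prod_v density (F v).
Proof.
rewrite /density prodf_div -!natr_prod card_ffun; congr (_%:R / _%:R); last first.
  by rewrite big_const iter_muln_1.
rewrite cardsE; have := card_family (fun v => mem (F v)).
rewrite foldrE big_map big_enum /= => <-.
by apply: eq_card => w; rewrite !inE.
Qed.

Lemma density_bigcup (T I : finType) (P : pred I) (A : I -> {set T}) :
  density (\bigcup_(i | P i) A i) <= \sum_(i | P i) density (A i).
Proof.
rewrite /density -mulr_suml ler_wpM2r ?invr_ge0// -natr_sum ler_nat.
elim/big_rec2: _ => [|i m X _ IH]; first by rewrite cards0.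
by rewrite (leq_trans (leq_card_setU _ _).1)// leq_add2l.
Qed.

Lemma exists_outside2 (T I J : finType) (P : pred I) (Q : pred J)
    (A : I -> {set T}) (B : J -> {set T}) : (0 < #|T|)%N ->
  \sum_(i | P i) density (A i) + \sum_(j | Q j) density (B j) < 1 ->
  exists w, (forall i, P i -> w \notin A i) /\ (forall j, Q j -> w \notin B j).
Proof.
move=> T0 lt1; set X := \bigcup_(i | P i) A i; set Y := \bigcup_(j | Q j) B j.
have : #|X :|: Y| != #|T|.
  apply: contraTneq lt1 => XYT; rewrite -leNgt.
  apply: le_trans (lerD (density_bigcup _ _) (density_bigcup _ _)).
  rewrite -/X -/Y -(densityT T0) /density -mulrDl ler_wpM2r ?invr_ge0//.
  by rewrite -natrD ler_nat cardsT -XYT (leq_card_setU _ _).1.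
rewrite -cardsT => XYT; case: (set_0Vmem (~: (X :|: Y))) => [|[w]].
  by move=> /(congr1 (@setC _)); rewrite setCK setC0 => E; rewrite E eqxx in XYT.
rewrite !inE negb_or => /andP[wX wY]; exists w; split=> i Pi.
  by apply: contra wX => wA; apply/bigcupP; exists i.
by apply: contra wY => wB; apply/bigcupP; exists i.
Qed.
End Density.

(** * Counting positions *)

Section Cards.
Local Open Scope nat_scope.
Variables (r n : nat).
Hypothesis r_gt1 : 1 < r.
Implicit Types (x : 'I_r * 'I_n) (i : 'I_r).

Lemma ordS_neq i : ordS i != i.
Proof.
apply/eqP => /(congr1 val) /= E; have lir := ltn_ord i.
have [ltr|ger] := ltnP i.+1 r; first by rewrite modn_small in E => //; lia.
have {ger} ir : i.+1 = r by lia.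
by rewrite ir modnn in E; lia.
Qed.

Lemma card_ord_lt m : m <= n -> #|[set l : 'I_n | l < m]| = m.
Proof.
move=> mn; rewrite -sum1_card.
rewrite (eq_bigl (fun l : 'I_n => l < m)); last by move=> l; rewrite inE.
by rewrite (big_ord_narrow mn) sum1_card card_ord.
Qed.

Lemma card_ord_ge m : m <= n -> #|[set l : 'I_n | m <= l]| = n - m.
Proof.
move=> mn; have <- : ~: [set l : 'I_n | l < m] = [set l : 'I_n | m <= l].
  by apply/setP => l; rewrite !inE -leqNgt.
by rewrite cardsCs setCK card_ord_lt// card_ord.
Qed.

Lemma card_buffer K : K <= n -> #|buffer r n K| = r * K.
Proof.
move=> leKn.
have -> : buffer r n K = setX setT [set l : 'I_n | n - K <= l].
  by apply/setP => x; rewrite !inE.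
by rewrite cardsX cardsT card_ord card_ord_ge ?leq_subr// subKn.
Qed.

Lemma card_earlier x : #|earlier x| = x.2.
Proof.
have -> : earlier x = setX [set x.1] [set l : 'I_n | l < x.2].
  by apply/setP => y; rewrite !inE.
by rewrite cardsX cards1 mul1n card_ord_lt// ltnW.
Qed.

(** The sum does not depend on [x]: moving [u] along its zone enlarges one of the
    two avoided sets exactly as much as it shrinks the other. *)
Lemma card_later x : #|later x| + x.2 = (2 * n).-1.
Proof.
have -> : later x = setX [set x.1] [set l : 'I_n | x.2.+1 <= l]
                    :|: setX [set ordS x.1] setT.
  by apply/setP => y; rewrite !inE andbT.
rewrite cardsU !cardsX !cards1 card_ord_ge// cardsT card_ord.
rewrite (_ : _ :&: _ = set0) ?cards0; first by have := ltn_ord x.2; lia.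
apply/setP => y; rewrite !inE andbT; case: eqP => //= ->.
by rewrite eq_sym (negPf (ordS_neq _)) andbF.
Qed.

Lemma card_arc K i : K <= n -> #|arc n K i| = n + K.
Proof.
move=> leKn.
have -> : arc n K i = setX [set i] setT
                    :|: setX [set ord_pred i] [set l : 'I_n | n - K <= l].
  apply/setP => y; rewrite !inE andbT; congr (_ || (_ && _)).
  by apply/eqP/eqP => [<-|->]; rewrite ?ordSK ?ord_predK.
rewrite cardsU !cardsX !cards1 card_ord_ge ?leq_subr// cardsT card_ord subKn//.
rewrite (_ : _ :&: _ = set0) ?cards0; first by lia.
apply/setP => y; rewrite !inE andbT; case: eqP => //= ->.
by rewrite -{1}(ord_predK i) (negPf (ordS_neq _)).
Qed.

Lemma disjoint_later_earlier x : later x :&: earlier x = set0.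
Proof.
apply/setP => y; rewrite !inE; case: (eqVneq y.1 x.1) => [->|]; last by rewrite andbF.
by rewrite eq_sym (negPf (ordS_neq _)) orbF /=; lia.
Qed.

End Cards.

(** * Probabilities of the bad events *)

Section Estimates.
Variable R : realFieldType.

Lemma prod_indicator (V : finType) (A : {set V}) (a : R) :
  \prod_v (if v \in A then a else 1) = a ^+ #|A|.
Proof. by rewrite -big_mkcond prodr_const. Qed.

Lemma density_avoids (V W : finType) (e : {set V}) (X : {set W}) :
  (0 < #|W|)%N ->
  density R [set w : {ffun V -> W} | [forall v in e, w v \notin X]] =
  (1 - density R X) ^+ #|e|.
Proof.
move=> W0; pose F v := if v \in e then ~: X else setT.
rewrite (_ : [set w | _] = [set w : {ffun V -> W} | [forall v, w v \in F v]]).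
  rewrite density_family -prod_indicator; apply: eq_bigr => v _.
  by rewrite /F; case: ifP => _; rewrite ?densityC ?densityT.
apply/setP => w; rewrite !inE; apply/forall_inP/forallP => [h v|h v ve].
  by rewrite /F; case: ifPn => // ve; rewrite inE h.
by have := h v; rewrite /F ve inE.
Qed.

(** Since [X] and [Y] are disjoint, a common vertex of [e] and [f] avoids both with
    probability [1 - X - Y], which is smaller than [(1 - X) * (1 - Y)]. Keeping
    this gain is what makes large intersections harmless. *)
Lemma density_clash (V W : finType) (e f : {set V}) (u : V) (x : W)
    (X Y : {set W}) : (0 < #|W|)%N -> u \in e -> u \in f -> X :&: Y = set0 ->
  density R [set w : {ffun V -> W} |
     [&& w u == x, [forall v in e, w v \notin X] & [forall v in f, w v \notin Y]]]
  <= #|W|%:R^-1 * (1 - density R X - density R Y) ^+ #|e :&: f|.-1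
     * (1 - density R X) ^+ #|e :\: f| * (1 - density R Y) ^+ #|f :\: e|.
Proof.
move=> W0 ue uf XY.
pose F v := if v == u then [set x] else
  (if v \in e then ~: X else setT) :&: (if v \in f then ~: Y else setT).
have cardI : #|(e :&: f) :\ u| = #|e :&: f|.-1.
  by rewrite (cardsD1 u (e :&: f)) inE ue uf.
have dXY : density R (~: X :&: ~: Y) = 1 - density R X - density R Y.
  rewrite -setCU densityC// -addrA -opprD; congr (1 - _).
  by rewrite /density cardsU XY cards0 subn0 natrD mulrDl.
apply: (@le_trans _ _ (density R [set w : {ffun V -> W} | [forall v, w v \in F v]])).
  rewrite /density ler_wpM2r ?invr_ge0// ler_nat subset_leq_card//.
  apply/subsetP => w; rewrite !inE => /and3P[/eqP wu /forall_inP we /forall_inP wf].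
  apply/forallP => v; rewrite /F; case: eqP => [->|_]; first by rewrite inE wu.
  rewrite inE; case: ifPn => [/we|_]; case: ifPn => [/wf|_]; rewrite !inE ?andbT//.
  by move=> -> ->.
rewrite density_family -cardI.
rewrite -(expr1 #|W|%:R^-1) -(cards1 u) -!prod_indicator -!big_split /=.
rewrite le_eqVlt; apply/orP; left; apply/eqP; apply: eq_bigr => v _.
rewrite /F !inE; case: eqP => [->|_]; first by rewrite ue uf /density cards1 !mulr1 mul1r.
by case: (v \in e); case: (v \in f) => /=;
  rewrite ?setIT ?setTI ?dXY ?densityC ?densityT ?mulr1 ?mul1r.
Qed.

(** The product [a * b] is at most [q ^ 2] for the mean [q] of [a] and [b], while
    [a + b - 1 = q ^ 2 - (1 - q) ^ 2 <= q ^ 2 * (1 - (1 - q) ^ 2)]. *)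
Lemma balanced_product_le (a b q : R) (n s : nat) : (0 < s <= n)%N ->
  0 <= a -> 0 <= b -> 1 <= a + b -> a + b = 2 * q -> q <= 1 ->
  (a + b - 1) ^+ s.-1 * a ^+ (n - s) * b ^+ (n - s)
  <= (1 - (1 - q) ^+ 2) ^+ s.-1 * (q ^+ n.-1) ^+ 2.
Proof.
move=> /andP[s0 sn] a0 b0 ab1 ab q1.
have q0 : 0 <= q by lra.
have -> : (q ^+ n.-1) ^+ 2 = (q ^+ 2) ^+ s.-1 * (q ^+ 2) ^+ (n - s).
  rewrite -exprD -exprM mulnC exprM; congr (_ ^+ _); lia.
rewrite -mulrA -exprMn mulrA -exprMn; apply: ler_pM.
- by rewrite exprn_ge0// subr_ge0.
- by rewrite exprn_ge0// mulr_ge0.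
- apply: lerXn2r; rewrite ?nnegrE; first by lra.
    by apply: mulr_ge0; [nra|rewrite sqr_ge0].
  have : (1 - q) ^+ 2 * q ^+ 2 <= (1 - q) ^+ 2 * 1.
    by apply: ler_wpM2l; rewrite ?sqr_ge0// expr_le1.
  by rewrite ab; nra.
- apply: lerXn2r; rewrite ?nnegrE ?mulr_ge0 ?sqr_ge0//.
  by have := sqr_ge0 (a - b); nra.
Qed.

(** The left-hand side is [y] times [s] copies of the least term of the geometric
    sum [\sum_(i < s) (1 - y) ^+ i], which is at most [1 / y]. *)
Lemma mulrn_expr_le (y : R) (s : nat) : 0 <= y <= 1 ->
  s%:R * (1 - y) ^+ s.-1 * y <= 1.
Proof.
move=> /andP[y0 y1]; have z0 : 0 <= 1 - y by rewrite subr_ge0.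
case: s => [|s]; first by rewrite !mul0r ler01.
apply: (@le_trans _ _ ((\sum_(i < s.+1) (1 - y) ^+ i) * y)).
  rewrite ler_wpM2r//; have -> : s.+1%:R * (1 - y) ^+ s = \sum_(i < s.+1) (1 - y) ^+ s.
    by rewrite sumr_const card_ord mulr_natl.
  apply: ler_sum => i _; apply: ler_wiXn2l => //; first by lra.
  by rewrite -ltnS.
have := subrX1 (1 - y) s.+1; set S := \sum_(i < s.+1) _ => E.
have -> : S * y = 1 - (1 - y) ^+ s.+1 by move: E; lra.
by have := exprn_ge0 s.+1 z0; lra.
Qed.

End Estimates.

(** * A sufficient condition for colorability *)

Section Colorability.
Variables (R : realFieldType) (H : hypergraph) (r n K : nat).
Hypotheses (r_gt1 : (1 < r)%N) (n_gt0 : (0 < n)%N) (leKn : (K <= n)%N).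
Hypothesis Hn : uniform n H.
Let m := #|edges H|.
(* The mean of the two avoidance probabilities for a clashing pair: the avoided
   sets have [2n - 1] positions out of [r * n] in total. *)
Let q : R := 1 - r%:R^-1 + (2 * (r * n)%:R)^-1.

Let W0 : (0 < #|{: 'I_r * 'I_n}|)%N.
Proof. by rewrite card_prod !card_ord muln_gt0 n_gt0 andbT ltnW. Qed.

Lemma density_misses e (i : 'I_r) : e \in edges H ->
  density R [set w : {ffun vertex H -> 'I_r * 'I_n} | avoids w e (arc n K i)] =
  (1 - (n + K)%:R / (r * n)%:R) ^+ n.
Proof.
move=> eH; rewrite density_avoids// /density card_arc// card_prod !card_ord.
by rewrite Hn.
Qed.

Lemma density_clash_le e f u (x : 'I_r * 'I_n) :
  e \in edges H -> f \in edges H -> u \in e :&: f ->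
  density R [set w : {ffun vertex H -> 'I_r * 'I_n} |
     [&& w u == x, avoids w e (later x) & avoids w f (earlier x)]]
  <= (r * n)%:R^-1 * ((1 - (1 - q) ^+ 2) ^+ #|e :&: f|.-1 * (q ^+ n.-1) ^+ 2).
Proof.
move=> eH fH /[dup] uef /setIP[ue uf].
have N1 : 1 <= (r * n)%:R :> R by rewrite ler1n muln_gt0 n_gt0 ltnW.
have N2 : 2 * n%:R <= (r * n)%:R :> R by rewrite -natrM ler_nat leq_mul2r r_gt1 orbT.
have n1 : 1 <= n%:R :> R by rewrite ler1n.
have cW : #|{: 'I_r * 'I_n}| = (r * n)%N by rewrite card_prod !card_ord.
apply: le_trans (density_clash R x W0 ue uf (disjoint_later_earlier r_gt1 x)) _.
rewrite cW -!mulrA ler_wpM2l ?invr_ge0//.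
set X := density R _; set Y := density R _.
have XY : X + Y = (2 * n%:R - 1) / (r * n)%:R.
  rewrite /X /Y /density -mulrDl cW -natrD card_earlier card_later//.
  by rewrite -subn1 natrB ?natrM// muln_gt0.
have X0 : 0 <= X := density_ge0 _ _.
have Y0 : 0 <= Y := density_ge0 _ _.
have Ni : 0 < (r * n)%:R^-1 :> R by rewrite invr_gt0 (lt_le_trans ltr01).
have XY1 : X + Y <= 1.
  by rewrite XY ler_pdivrMr ?(lt_le_trans ltr01)// mul1r; lra.
have qE : X + Y = 2 * (1 - q).
  rewrite XY /q natrM; field.
  by rewrite !pnatr_eq0 -!lt0n n_gt0 ltnW.
have -> : 1 - X - Y = (1 - X) + (1 - Y) - 1 by ring.
have De : #|e :\: f| = (n - #|e :&: f|)%N by rewrite -(Hn eH) -(cardsID f e) addKn.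
have Df : #|f :\: e| = (n - #|e :&: f|)%N.
  by rewrite -(Hn fH) -(cardsID e f) setIC addKn.
rewrite De Df mulrA. apply: balanced_product_le.
- rewrite -(Hn eH) subset_leq_card ?subsetIl// andbT.
  by apply/card_gt0P; exists u.
- by lra.
- by lra.
- by lra.
- by move: qE; lra.
- by move: qE; lra.
Qed.

(** The weightings excluded by the second hypothesis of [panchromatic_color], for
    a given ordered pair of edges; [e] and [f] may coincide. *)
Definition conflict e f : {set {ffun vertex H -> 'I_r * 'I_n}} :=
  \bigcup_(u in e :&: f) \bigcup_(x in buffer r n K)
    [set w : {ffun vertex H -> 'I_r * 'I_n} |
       [&& w u == x, avoids w e (later x) & avoids w f (earlier x)]].

Lemma density_conflict (sigma : R) e f :
  (forall s, (s <= n)%N -> s%:R * (1 - (1 - q) ^+ 2) ^+ s.-1 <= sigma) ->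
  e \in edges H -> f \in edges H ->
  density R (conflict e f) <= K%:R / n%:R * sigma * (q ^+ n.-1) ^+ 2.
Proof.
move=> sigmaP eH fH; have := sigmaP #|e :&: f|; rewrite -{1}(Hn eH).
move=> /(_ (subset_leq_card (subsetIl e f))) sP.
apply: le_trans (density_bigcup _ _ _) _.
have step u : u \in e :&: f ->
    density R (\bigcup_(x in buffer r n K)
      [set w : {ffun vertex H -> 'I_r * 'I_n} | [&& w u == x, avoids w e (later x)
                             & avoids w f (earlier x)]])
    <= K%:R / n%:R * ((1 - (1 - q) ^+ 2) ^+ #|e :&: f|.-1 * (q ^+ n.-1) ^+ 2).
  move=> uef; apply: le_trans (density_bigcup _ _ _) _.
  apply: le_trans (ler_sum _ (fun x _ => density_clash_le x eH fH uef)) _.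
  rewrite sumr_const card_buffer// -[leLHS]mulr_natl mulrA.
  rewrite le_eqVlt; apply/orP; left; apply/eqP; congr (_ * _).
  by rewrite !natrM; field; rewrite !pnatr_eq0 -!lt0n n_gt0 ltnW.
apply: le_trans (ler_sum _ step) _; rewrite sumr_const -[leLHS]mulr_natl.
rewrite mulrCA -mulrA ler_wpM2l ?divr_ge0// mulrA ler_wpM2r//.
by rewrite sqr_ge0.
Qed.

Lemma colorable_of_density (sigma : R) :
  (forall s, (s <= n)%N -> s%:R * (1 - (1 - q) ^+ 2) ^+ s.-1 <= sigma) ->
  m%:R * r%:R * (1 - (n + K)%:R / (r * n)%:R) ^+ n
    + m%:R ^+ 2 * (K%:R / n%:R) * sigma * (q ^+ n.-1) ^+ 2 < 1 ->
  panchromatic_colorable r H.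
Proof.
move=> sigmaP lt1.
have [||w [wA wB]] := @exists_outside2 R {ffun vertex H -> 'I_r * 'I_n} _ _
  (fun z => (z.1 \in edges H) && true) (fun z => (z.1 \in edges H) && (z.2 \in edges H))
  (fun z : _ * 'I_r => [set w : {ffun vertex H -> 'I_r * 'I_n} | avoids w z.1 (arc n K z.2)])
  (fun z => conflict z.1 z.2).
- by rewrite card_ffun expn_gt0 W0.
- apply: le_lt_trans lt1; apply: lerD.
    rewrite -(pair_big (fun e => e \in edges H) predT
       (fun e i => density R [set w : {ffun vertex H -> 'I_r * 'I_n} | avoids w e (arc n K i)])) /=.
    rewrite (eq_bigr (fun=> r%:R * (1 - (n + K)%:R / (r * n)%:R) ^+ n)).
      by rewrite sumr_const -[leLHS]mulr_natl mulrA.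
    move=> e eH; rewrite (eq_bigr _ (fun i _ => density_misses i eH)).
    by rewrite sumr_const card_ord -[LHS]mulr_natl.
  rewrite -(pair_big (fun e => e \in edges H) (fun f => f \in edges H)
       (fun e f => density R (conflict e f))) /=.
  set Z := (q ^+ n.-1) ^+ 2.
  have -> : m%:R ^+ 2 * (K%:R / n%:R) * sigma * Z
          = m%:R * (m%:R * (K%:R / n%:R * sigma * Z)) by ring.
  rewrite [leRHS]mulr_natl -sumr_const; apply: ler_sum => e eH.
  rewrite [leRHS]mulr_natl -sumr_const; apply: ler_sum => f fH.
  exact: density_conflict.
exists (color K w); apply: panchromatic_color.
  by move=> e i eH; have := wA (e, i); rewrite /= eH inE; apply.
move=> e f v eH fH ve vf vb; apply/negP => wef.
have := wB (e, f); rewrite /= eH fH => /(_ isT)/negP[].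
apply/bigcupP; exists v; first by rewrite inE ve vf.
by apply/bigcupP; exists (w v) => //; rewrite inE eqxx.
Qed.
End Colorability.

(** * Choice of the buffer width *)

Section Asymptotics.
Variable R : realType.

Lemma expR_half_le2 : expR 2^-1 <= 2 :> R.
Proof.
have := expR_ge1Dx (- 2^-1 : R); rewrite expRN => h.
have e0 := expR_gt0 (2^-1 : R).
suff : expR 2^-1 * 2^-1 <= 1 :> R by lra.
rewrite -[leRHS](divff (lt0r_neq0 e0)) ler_wpM2l ?(ltW e0)//; lra.
Qed.

Lemma ln2_ge_half : 2^-1 <= ln 2 :> R.
Proof. by rewrite -[leLHS]expRK ler_ln ?posrE ?expR_gt0// expR_half_le2. Qed.

Lemma ln_le_sqrt (x : R) : 0 < x -> ln x <= 2 * Num.sqrt x.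
Proof.
move=> x0; have s0 : 0 < Num.sqrt x by rewrite sqrtr_gt0.
rewrite -{1}(sqr_sqrtr (ltW x0)) lnXn// -[leLHS]mulr_natl ler_wpM2l//.
exact: ltW (ln_sublinear s0).
Qed.

Lemma trunc_log_le_ln n : (1 < n)%N -> (trunc_log 2 n).+1%:R <= 4 * ln n%:R :> R.
Proof.
move=> n1; have n0 : (0 < n)%N by lia.
have ln2 := ln2_ge_half.
have l2n : ln 2 <= ln n%:R :> R by rewrite ler_ln ?posrE ?ltr0n// ler_nat.
have : (trunc_log 2 n)%:R * ln 2 <= ln n%:R :> R.
  rewrite mulr_natl -lnXn// ler_ln ?posrE ?exprn_gt0 ?ltr0n//.
  by rewrite -natrX ler_nat trunc_logP.
have t0 : 0 <= (trunc_log 2 n)%:R :> R by [].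
rewrite -natr1; nra.
Qed.

Lemma expr_1B_le (d n : nat) : (0 < n)%N -> (d <= n)%N ->
  (1 - d%:R / n%:R) ^+ n <= (2 ^+ d)^-1 :> R.
Proof.
move=> n0 dn; have n0' : 0 < n%:R :> R by rewrite ltr0n.
apply: (@le_trans _ _ (expR (- (d%:R / n%:R)) ^+ n)).
  apply: lerXn2r; rewrite ?nnegrE ?expR_ge0 ?expR_ge1Dx//.
  by rewrite subr_ge0 ler_pdivrMr// mul1r ler_nat.
rewrite -expRM_natl mulrN mulrC divfK ?gt_eqF// expRN.
rewrite lef_pV2 ?posrE ?expR_gt0 ?exprn_gt0//.
rewrite -[d%:R]mulr1 expRM_natl lerXn2r ?nnegrE ?expR_ge0//.
have := expR_ge1Dx (1 : R); lra.
Qed.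

Variables (r n : nat).
Hypotheses (r_gt1 : (1 < r)%N) (n_gt1 : (1 < n)%N).
Let Q : R := 1 - r%:R^-1.
Let q : R := 1 - r%:R^-1 + (2 * (r * n)%:R)^-1.

Let rV_gt0 : 0 < r%:R^-1 :> R.
Proof. by rewrite invr_gt0 ltr0n ltnW. Qed.

Let rV_le : r%:R^-1 <= 2^-1 :> R.
Proof. by rewrite lef_pV2 ?posrE ?ltr0n ?ler_nat// ltnW. Qed.

Let nV_gt0 : 0 < n%:R^-1 :> R.
Proof. by rewrite invr_gt0 ltr0n ltnW. Qed.

Let nV_le : n%:R^-1 <= 2^-1 :> R.
Proof. by rewrite lef_pV2 ?posrE ?ltr0n ?ler_nat// ltnW. Qed.

Let qE : q = Q + r%:R^-1 * n%:R^-1 / 2.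
Proof. by rewrite /q natrM !invfM mulrC. Qed.

Let inv_bounds : [/\ 0 < r%:R^-1 :> R, r%:R^-1 <= 2^-1 :> R, n%:R^-1 <= 2^-1 :> R,
  0 < r%:R^-1 * n%:R^-1 :> R & r%:R^-1 * n%:R^-1 <= r%:R^-1 / 2 :> R].
Proof. by rewrite mulr_gt0// ler_pM2l. Qed.

(** Rounding to [n] levels replaces [Q] by [q <= Q * (1 + 1 / (2n))], and the
    [n]-th power of the last factor is bounded by [sqrt e <= 2]. *)
Lemma expr_q_le : (q ^+ n.-1) ^+ 2 <= 16 * (Q ^+ n) ^+ 2.
Proof.
have n0 : n%:R != 0 :> R by rewrite pnatr_eq0 -lt0n ltnW.
have [rV0 rVle nVle rnV0 rnVle] := inv_bounds.
have Q12 : 2^-1 <= Q by rewrite /Q; lra.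
have q12 : 2^-1 <= q by rewrite qE; lra.
have Qn0 : 0 <= Q ^+ n by rewrite exprn_ge0//; lra.
have qn : q ^+ n <= 2 * Q ^+ n.
  apply: (@le_trans _ _ ((Q * expR (n%:R^-1 / 2)) ^+ n)).
    apply: lerXn2r; rewrite ?nnegrE; [lra|by rewrite mulr_ge0 ?expR_ge0//; lra|].
    apply: (@le_trans _ _ (Q * (1 + n%:R^-1 / 2))).
      rewrite qE; suff : r%:R^-1 * n%:R^-1 <= Q * n%:R^-1 by lra.
      by rewrite ler_wpM2r ?(ltW nV_gt0)//; lra.
    by rewrite ler_wpM2l ?expR_ge1Dx//; lra.
  rewrite exprMn -expRM_natl mulrA divff// mul1r mulrC ler_wpM2r//.
  exact: expR_half_le2.
have q1 : 0 <= q ^+ n.-1 by rewrite exprn_ge0//; lra.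
have qS : q ^+ n = q * q ^+ n.-1 by rewrite -exprS prednK// ltnW.
have : q ^+ n.-1 <= 4 * Q ^+ n by rewrite qS in qn; nra.
move=> h; have -> : 16 * (Q ^+ n) ^+ 2 = (4 * Q ^+ n) ^+ 2 by ring.
by apply: lerXn2r; rewrite ?nnegrE// mulr_ge0.
Qed.

Let y01 : 0 <= (1 - q) ^+ 2 <= 1.
Proof.
have [rV0 rVle nVle rnV0 rnVle] := inv_bounds.
rewrite sqr_ge0/= expr_le1// qE /Q; lra.
Qed.

Lemma overlap_le_size s : (s <= n)%N ->
  s%:R * (1 - (1 - q) ^+ 2) ^+ s.-1 <= n%:R.
Proof.
move=> sn; have /andP[y0 y1] := y01.
apply: (@le_trans _ _ s%:R); last by rewrite ler_nat.
by apply: ler_piMr => //; apply: exprn_ile1; lra.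
Qed.

(** Here [1 - q = 1/r - 1/(2rn) >= 1/(2r)]. *)
Lemma overlap_le_colors s : s%:R * (1 - (1 - q) ^+ 2) ^+ s.-1 <= 4 * r%:R ^+ 2.
Proof.
have [rV0 rVle nVle rnV0 rnVle] := inv_bounds.
have r0 : 0 < r%:R ^+ 2 :> R by rewrite exprn_gt0// ltr0n ltnW.
have := mulrn_expr_le s y01; have /andP[_ y1] := y01.
set t := s%:R * _; have t0 : 0 <= t.
  by rewrite mulr_ge0// exprn_ge0// subr_ge0.
have : (4 * r%:R ^+ 2)^-1 <= (1 - q) ^+ 2.
  have -> : (4 * r%:R ^+ 2)^-1 = (r%:R^-1 / 2) ^+ 2 :> R.
    by rewrite invfM expr_div_n exprVn mulrC; congr (_ * _^-1); ring.
  by apply: lerXn2r; rewrite ?nnegrE ?qE /Q; lra.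
move=> yge ty; rewrite -[leRHS]mul1r -ler_pdivrMr ?(mulr_gt0 _ r0)//.
by apply: le_trans ty; rewrite ler_wpM2l.
Qed.

(** The buffer of each zone has width [(r - 1) * d] with [2 ^ d > n], so
    [d = O(ln n)]: then [(1 - d/n) ^ n <= 2 ^ (- d) < 1/n] bounds the first kind
    of failure by [x * r / n], and the second kind is at most
    [64 * x ^ 2 * r * ln n * sigma / n]. *)
Lemma colorable_of_few_edges (H : hypergraph) (x sigma : R) :
  uniform n H -> 64 * (r%:R * ln n%:R) <= n%:R :> R -> 0 <= x -> 0 <= sigma ->
  (forall s, (s <= n)%N -> s%:R * (1 - (1 - q) ^+ 2) ^+ s.-1 <= sigma) ->
  #|edges H|%:R * Q ^+ n <= x ->
  4 * (x * r%:R) <= n%:R ->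
  128 * (x ^+ 2 * r%:R * ln n%:R * sigma) <= n%:R ->
  panchromatic_colorable r H.
Proof.
move=> Hn rn x0 sig0 sigmaP mx h1 h2.
have n0 : 0 < n%:R :> R by rewrite ltr0n ltnW.
have r0 : 0 < r%:R :> R by rewrite ltr0n ltnW.
have [rV0 rVle _ _ _] := inv_bounds.
have := trunc_log_ltn n (isT : (1 < 2)%N); have := trunc_log_le_ln n_gt1.
move: (trunc_log 2 n).+1 => d dln n_lt.
have Kr : (r.-1 * d)%:R <= r%:R * (4 * ln n%:R) :> R.
  rewrite natrM ler_pM//; first by rewrite ler_nat leq_pred.
have ln0 : 0 <= ln n%:R :> R by rewrite ln_ge0// ler1n ltnW.
have leKn : (r.-1 * d <= n)%N.
  by rewrite -(ler_nat R); have := mulr_ge0 (ltW r0) ln0; lra.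
have dn : (d <= n)%N by apply: leq_trans leKn; rewrite leq_pmull// -subn1 subn_gt0.
have Qn0 : 0 <= Q ^+ n by rewrite exprn_ge0// /Q; lra.
have m0 : 0 <= #|edges H|%:R :> R by [].
apply: (@colorable_of_density R H r n (r.-1 * d) r_gt1 (ltnW n_gt1) leKn Hn sigma) => //.
have -> : 1 - (n + r.-1 * d)%:R / (r * n)%:R = Q * (1 - d%:R / n%:R).
  rewrite natrD !natrM -subn1 natrB ?(ltnW r_gt1)// /Q.
  move: r%:R n%:R d%:R r0 n0 => a b c a0 b0.
  by field; rewrite !gt_eqF.
have dle : (1 - d%:R / n%:R) ^+ n <= n%:R^-1 :> R.
  apply: le_trans (expr_1B_le (ltnW n_gt1) dn) _.
  rewrite lef_pV2 ?posrE ?exprn_gt0//.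
  by rewrite -natrX ler_nat ltnW.
have term1 : #|edges H|%:R * r%:R * (Q * (1 - d%:R / n%:R)) ^+ n <= 4^-1.
  rewrite exprMn.
  have -> : #|edges H|%:R * r%:R * (Q ^+ n * (1 - d%:R / n%:R) ^+ n)
    = (#|edges H|%:R * Q ^+ n) * r%:R * (1 - d%:R / n%:R) ^+ n by ring.
  apply: (@le_trans _ _ (x * r%:R * n%:R^-1)).
    apply: ler_pM => //; first by rewrite !mulr_ge0.
      by rewrite exprn_ge0// subr_ge0 ler_pdivrMr// mul1r ler_nat.
    by rewrite ler_wpM2r// ltW.
  by rewrite ler_pdivrMr//; lra.
suff term2 : #|edges H|%:R ^+ 2 * ((r.-1 * d)%:R / n%:R) * sigma * (q ^+ n.-1) ^+ 2
    <= 2^-1 by move: term1 term2; rewrite -/q; lra.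
apply: (@le_trans _ _ (#|edges H|%:R ^+ 2 * (r%:R * (4 * ln n%:R) / n%:R) * sigma
                       * (16 * (Q ^+ n) ^+ 2))).
  apply: ler_pM; rewrite ?sqr_ge0 ?expr_q_le// ?mulr_ge0 ?sqr_ge0 ?invr_ge0 ?(ltW n0)//.
  rewrite ler_wpM2r// ler_wpM2l ?sqr_ge0// ler_wpM2r// invr_ge0.
  exact: ltW.
have -> : #|edges H|%:R ^+ 2 * (r%:R * (4 * ln n%:R) / n%:R) * sigma
           * (16 * (Q ^+ n) ^+ 2)
   = (#|edges H|%:R * Q ^+ n) ^+ 2 * (64 * (r%:R * ln n%:R * sigma)) / n%:R by ring.
rewrite ler_pdivrMr//; apply: (@le_trans _ _ (x ^+ 2 * (64 * (r%:R * ln n%:R * sigma)))).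
  rewrite ler_wpM2r ?mulr_ge0 ?(ltW r0)//.
  by apply: lerXn2r; rewrite ?nnegrE// mulr_ge0.
by lra.
Qed.

End Asymptotics.

Theorem theorem1p3 (R : realType) :
  exists2 c : R, 0 < c &
    forall n r : nat, (2 <= r)%N -> (r <= n)%N ->
      r%:R <= c * (n%:R / ln n%:R) ->
      c * Num.max ((n%:R `^ 4^-1) / (r%:R * Num.sqrt r%:R))
                  (Num.sqrt n%:R)^-1
        * (r%:R / (r%:R - 1)) ^+ n
      <= (p n r)%:R.
Proof.
exists 64^-1; first by lra.
move=> n r r1 rn rc; have n1 : (1 < n)%N := leq_trans r1 rn.
have [[H [Hn Hcol <-]] _] := pP n r1.
rewrite leNgt; apply/negP => mlt; apply: Hcol.
have n0 : 1 <= n%:R :> R by rewrite ler1n ltnW.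
have r0 : 2 <= r%:R :> R by rewrite ler_nat.
have rn' : r%:R <= n%:R :> R by rewrite ler_nat.
have ln0 : 0 < ln n%:R :> R by rewrite ln_gt0// ltr1n.
have rln : 64 * (r%:R * ln n%:R) <= n%:R :> R.
  by move: rc; rewrite [_^-1 * _]mulrA ler_pdivlMr//; lra.
have mQ (x : R) : #|edges H|%:R < 64^-1 * x * (r%:R / (r%:R - 1)) ^+ n ->
    #|edges H|%:R * (1 - r%:R^-1) ^+ n <= 64^-1 * x.
  have -> : 1 - r%:R^-1 = (r%:R / (r%:R - 1))^-1 :> R.
    by field; apply/andP; split; lra.
  by rewrite exprVn ler_pdivrMr ?exprn_gt0 ?divr_gt0//; lra.
have sn1 : 1 <= Num.sqrt n%:R :> R by rewrite -[leLHS]sqrtr1 ler_wsqrtr.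
have sr1 : 1 <= Num.sqrt r%:R :> R by rewrite -[leLHS]sqrtr1 ler_wsqrtr; lra.
have snE : Num.sqrt n%:R ^+ 2 = n%:R :> R by rewrite sqr_sqrtr; lra.
have srE : Num.sqrt r%:R ^+ 2 = r%:R :> R by rewrite sqr_sqrtr; lra.
(* In the first case the maximum is [1 / sqrt n], in the second it is
   [n ^ (1/4) / r ^ (3/2)]. *)
move: mlt; rewrite /Num.max; case: ifP => _ /mQ mx.
  apply: (colorable_of_few_edges r1 n1 Hn rln _ _ (@overlap_le_size R r n r1 n1) mx).
  - by rewrite mulr_ge0 ?invr_ge0 ?sqrtr_ge0.
  - by lra.
  - have : (Num.sqrt n%:R)^-1 * r%:R <= 1 * n%:R :> R.
      by rewrite ler_pM ?invr_ge0 ?invf_le1//; lra.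
    by lra.
  - rewrite exprMn (exprVn (Num.sqrt _)) snE; have nn : n%:R^-1 * n%:R = 1 :> R.
      by rewrite mulVf//; lra.
    have -> : 128 * (64^-1 ^+ 2 / n%:R * r%:R * ln n%:R * n%:R)
      = 128 * 64^-1 ^+ 2 * (r%:R * ln n%:R) * (n%:R^-1 * n%:R) :> R by ring.
    by rewrite nn; lra.
have a1 : n%:R `^ 4^-1 <= n%:R :> R by apply: ler1_powR => //; lra.
have a0 : 0 <= n%:R `^ 4^-1 :> R := powR_ge0 _ _.
have a2 : (n%:R `^ 4^-1) ^+ 2 = Num.sqrt n%:R :> R.
  rewrite -powR_mulrn// -powRrM -powR12_sqrt; last by lra.
  by congr (_ `^ _); lra.
have rV : r%:R^-1 * r%:R = 1 :> R by rewrite mulVf//; lra.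
apply: (colorable_of_few_edges r1 n1 Hn rln _ _
          (fun s _ => overlap_le_colors R r1 n1 s) mx).
- by apply: mulr_ge0; [lra | apply: divr_ge0 => //; apply: mulr_ge0; lra].
- by rewrite mulr_ge0// sqr_ge0.
- have -> : 4 * (64^-1 * (n%:R `^ 4^-1 / (r%:R * Num.sqrt r%:R)) * r%:R)
    = 16^-1 * (n%:R `^ 4^-1 / Num.sqrt r%:R) :> R.
    by field; apply/andP; split; lra.
  have : n%:R `^ 4^-1 / Num.sqrt r%:R <= n%:R * 1 :> R.
    by rewrite ler_pM ?invr_ge0 ?invf_le1//; lra.
  by lra.
- have -> : 128 * ((64^-1 * (n%:R `^ 4^-1 / (r%:R * Num.sqrt r%:R))) ^+ 2
              * r%:R * ln n%:R * (4 * r%:R ^+ 2))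
    = 8^-1 * ((n%:R `^ 4^-1) ^+ 2 * ln n%:R) * (r%:R / Num.sqrt r%:R ^+ 2) :> R.
    by field; apply/andP; split; lra.
  rewrite srE divff ?mulr1; last by lra.
  have ls : ln n%:R <= 2 * Num.sqrt n%:R :> R by apply: ln_le_sqrt; lra.
  rewrite a2 -{3}snE; nra.
Qed.
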